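(* Let $K$ be a field, $S=K[x_1,\ldots,x_n]$, and let $I\subset S$ be a componentwise polymatroidal ideal generated in at most $2$ degrees (i.e. the degrees of the elements of the minimal monomial generating set of $I$ take at most two values). Then $I^k$ is componentwise polymatroidal for all $k\geq 1$.
   Context: For a monomial ideal $I$, $G(I)$ denotes its unique minimal set of monomial generators, and $\deg_{x_i}(u)$ is the exponent of $x_i$ in the monomial $u$. A monomial ideal $I$ is polymatroidal if it is generated in a single degree (all elements of $G(I)$ have the same degree) and, for all $u,v\in G(I)$ and every $i$ with $\deg_{x_i}(u)>\deg_{x_i}(v)$, there exists $j$ with $\deg_{x_j}(u)<\deg_{x_j}(v)$ such that $x_j(u/x_i)\in I$ (the zero ideal satisfies this vacuously). For a monomial ideal $I$, $I_{\langle j\rangle}$ denotes the ideal generated by all monomials of degree $j$ in $I$. $I$ is componentwise polymatroidal if $I_{\langle j\rangle}$ is polymatroidal for all $j$. *)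

(* Defs.v *)
From HB Require Import structures.
From mathcomp Require Import all_boot all_order all_algebra.
From mathcomp Require Import mpoly.
From Stdlib Require Import Classical_Prop.

Set Implicit Arguments.
Unset Strict Implicit.
Unset Printing Implicit Defensive.

Import GRing.Theory.
Local Open Scope ring_scope.

Section Ideals.
Variable R : comNzRingType.

(* Ideals are Prop-valued predicates; unlike [idealr_closed], the unit ideal
   is allowed. *)
Definition is_ideal (I : R -> Prop) : Prop :=
  [/\ I 0, forall a b, I a -> I b -> I (a + b) & forall a b, I b -> I (a * b)].

Definition ideal_gen (B : R -> Prop) : R -> Prop :=
  fun p => forall J, is_ideal J -> (forall b, B b -> J b) -> J p.

Definition ideal_mul (I J : R -> Prop) : R -> Prop :=
  ideal_gen (fun p => exists a b, [/\ I a, J b & p = a * b]).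

Definition ideal_exp (I : R -> Prop) (k : nat) : R -> Prop :=
  iter k (ideal_mul I) (fun _ => True).

Lemma ideal_gen_ideal B : is_ideal (ideal_gen B).
Proof.
split=> [J [h0 _ _] _|a b ha hb J hJ hB|a b hb J hJ hB] //.
  by have [_ hD _] := hJ; apply: hD; [apply: ha|apply: hb].
by have [_ _ hM] := hJ; apply: hM; apply: hb.
Qed.

Lemma ideal_gen_sub (B : R -> Prop) b : B b -> ideal_gen B b.
Proof. by move=> hb J _; apply. Qed.

Lemma ideal_exp1 I : is_ideal I -> forall p, ideal_exp I 1 p <-> I p.
Proof.
move=> hI p; split=> [|hp].
  by apply=> // _ [a [b [ha _ ->]]]; rewrite mulrC; have [_ _] := hI; apply.
by apply: ideal_gen_sub; exists p, 1; rewrite mulr1.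
Qed.

End Ideals.

Section MonomialIdeals.
Variables (K : fieldType) (n : nat).
Implicit Types (I : {mpoly K[n]} -> Prop) (B G : 'X_{1..n} -> Prop).

(* A monomial is represented by its exponent vector [m : 'X_{1..n}]. *)
Definition monomial_gen B : {mpoly K[n]} -> Prop :=
  ideal_gen (fun p => exists2 m, B m & p = 'X_[m]).

Definition generates B I : Prop := forall p, I p <-> monomial_gen B p.

Definition monomial_ideal I : Prop := exists B, generates B I.

Definition minimal_generating_set G I : Prop :=
  generates G I /\
  forall G', (forall m, G' m -> G m) -> generates G' I -> forall m, G m -> G' m.

(* For a monomial ideal the minimal generating set exists and is unique, see
   [mingens_minimal] and [minimal_generating_set_unique]. *)
Definition mingens I : 'X_{1..n} -> Prop :=
  fun u => exists2 G, minimal_generating_set G I & G u.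

Definition polymatroidal I : Prop :=
  [/\ monomial_ideal I,
      forall u v, mingens I u -> mingens I v -> mdeg u = mdeg v
    & forall u v, mingens I u -> mingens I v ->
      forall i : 'I_n, (v i < u i)%N ->
      exists2 j : 'I_n, (u j < v j)%N & I 'X_[u - U_(i) + U_(j)] ].

Definition component I (j : nat) : {mpoly K[n]} -> Prop :=
  monomial_gen (fun m => mdeg m = j /\ I 'X_[m]).

Definition componentwise_polymatroidal I : Prop :=
  monomial_ideal I /\ forall j, polymatroidal (component I j).

Definition generated_in_at_most_two_degrees I : Prop :=
  exists d1 d2 : nat, forall u, mingens I u -> mdeg u = d1 \/ mdeg u = d2.

Lemma monomial_genP B p :
  monomial_gen B p <->
  forall m, m \in msupp p -> exists2 b, B b & (b <= m)%MM.
Proof.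
split=> [hp|hp].
  apply: (hp (fun q => forall m, m \in msupp q -> exists2 b, B b & (b <= m)%MM)).
    split=> [m|a b ha hb m|a b hb m]; first by rewrite msupp0.
      by move/msuppD_le; rewrite mem_cat => /orP[/ha|/hb].
    move/msuppM_le/allpairsP=> [[m1 m2] /= [_ /hb [c hc le_c] ->]].
    by exists c => //; apply: lepm_trans le_c _; apply: lem_addl.
  move=> _ [m hm ->] m'; rewrite msuppX inE => /eqP->.
  by exists m => //; apply: lepm_refl.
have [h0 hD hM] := ideal_gen_ideal (fun p : {mpoly K[n]} =>
  exists2 m, B m & p = 'X_[m]).
rewrite (mpolyE p) big_seq; apply: (big_ind (monomial_gen B)) => //.
move=> m /hp [b hb le_b]; rewrite -(submK le_b) mpolyXD scalerAl.
by apply: hM; apply: ideal_gen_sub; exists b.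
Qed.

Lemma monomial_genXP B m :
  monomial_gen B 'X_[m] <-> exists2 b, B b & (b <= m)%MM.
Proof.
rewrite monomial_genP; split=> [hm|hm m'].
  by apply: hm; rewrite msuppX inE.
by rewrite msuppX inE => /eqP->.
Qed.

Definition div_minimal I : 'X_{1..n} -> Prop :=
  fun u => I 'X_[u] /\ forall v, I 'X_[v] -> (v <= u)%MM -> v = u.

Lemma div_minimal_sub B I u : generates B I -> div_minimal I u -> B u.
Proof.
move=> hB [/hB/monomial_genXP[b Bb le_b] hu]; rewrite -(hu b) //.
by apply/hB/monomial_genXP; exists b => //; apply: lepm_refl.
Qed.

Lemma div_minimal_generates I : monomial_ideal I -> generates (div_minimal I) I.
Proof.
move=> [B hB].
have below d m : (mdeg m < d)%N -> I 'X_[m] ->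
    exists2 b, div_minimal I b & (b <= m)%MM.
  elim: d m => // d IHd m lt_m Im.
  case: (classic (div_minimal I m)) => [hm|no].
    by exists m => //; apply: lepm_refl.
  apply: NNPP => no_b; apply: no; split=> // v Iv le_v.
  apply/eqP/negPn/negP => neq_v; apply: no_b.
  have lt_v : (mdeg v < mdeg m)%N.
    rewrite -(submK le_v) mdegD -{1}[mdeg v]add0n ltn_add2r lt0n mdeg_eq0.
    by apply: contra neq_v => /eqP e; rewrite -(submK le_v) e add0m.
  have [b hb le_b] := IHd v (leq_trans lt_v lt_m) Iv.
  by exists b => //; apply: lepm_trans le_b le_v.
move=> p; rewrite monomial_genP; split=> [/hB/monomial_genP hp m|hp].
  move=> /hp hm; apply: below (leqnn (mdeg m).+1) _.
  exact/hB/monomial_genXP.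
apply/hB/monomial_genP => m /hp [b [/hB/monomial_genXP [c Bc le_c] _] le_b].
by exists c => //; apply: lepm_trans le_c le_b.
Qed.

Lemma minimal_generating_setP I G : monomial_ideal I ->
  minimal_generating_set G I <-> forall u, G u <-> div_minimal I u.
Proof.
move=> hI; have gI := div_minimal_generates hI; split=> [[gG minG] u|hG].
  split; last exact: div_minimal_sub.
  by apply: minG => // m; apply: div_minimal_sub.
split=> [p|G' _ gG' m /hG]; last exact: div_minimal_sub.
rewrite gI !monomial_genP; split=> h m /h [b /hG hb le_b]; by exists b.
Qed.

Lemma minimal_generating_set_unique I G G' : monomial_ideal I ->
  minimal_generating_set G I -> minimal_generating_set G' I ->
  forall u, G u <-> G' u.
Proof.
move=> hI /(minimal_generating_setP _ hI) hG.
by move=> /(minimal_generating_setP _ hI) hG' u; rewrite hG hG'.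
Qed.

Lemma mingensE I u : monomial_ideal I -> mingens I u <-> div_minimal I u.
Proof.
move=> hI; split=> [[G /(minimal_generating_setP _ hI) -> //]|hu].
by exists (div_minimal I) => //; apply/minimal_generating_setP.
Qed.

Lemma mingens_minimal I :
  monomial_ideal I -> minimal_generating_set (mingens I) I.
Proof. by move=> hI; apply/minimal_generating_setP => // u; apply: mingensE. Qed.

End MonomialIdeals.

(* Main.v *)
Require Import Defs.
From mathcomp Require Import all_boot all_order all_algebra.
From mathcomp Require Import mpoly.
From mathcomp Require Import zify.

(** Both the hypothesis and the conclusion are statements about sets of
    exponent vectors.  A component [component I j] is polymatroidal exactly when
    the set of exponents of degree [j] in [I] has the exchange property
    ([polymatroidal_componentP]), and the theorem follows from two facts.

    First, exchange survives Minkowski sums ([exchange_msum]), hence products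
    of polymatroidal ideals are polymatroidal.  To exchange [x = a + b] against
    [y = a' + b'] at [i], apply the exchange property of one summand at [i].
    This moves [x] to [x - U_(i) + U_(l)].  If [x l < y l], this is the required
    exchange; otherwise the new vector exceeds [y] at [l], so one of its summands
    exceeds the matching summand of [y] there and can be exchanged at [l] in
    turn.
    Every exchange brings the pair of summands strictly closer to [(a', b')],
    so the process stops.

    Second, each component of [I^k] is such a product.  Let [P] and [Q] be the
    exponents of degrees [d1 <= d2] in [I], where [d1] and [d2] are the two
    generating degrees.  Then [I^k] is generated by the sums of [k - q] elements
    of [P] and [q] elements of [Q].  A monomial of degree [j] that is divisible
    by such a sum with room [d2 - d1] to spare is also divisible by one with
    [q + 1] in place of [q]: enlarge one of the [P]-summands to an element of
    [Q] ([two_degree_multiples_step]).  Hence only the largest [q] with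
    [(k - q) * d1 + q * d2 <= j] matters, and the component is the product of
    [k - q] copies of [P], [q] copies of [Q] and a power of the maximal ideal
    ([two_degree_power_exchange]). *)

Set Implicit Arguments.
Unset Strict Implicit.
Unset Printing Implicit Defensive.

Import GRing.Theory.
Local Open Scope ring_scope.

(** * Sets of exponent vectors with the exchange property *)

Section ExchangeSets.
Variable n : nat.
Implicit Types (A B C : 'X_{1..n} -> Prop) (a b x m u v : 'X_{1..n}).

Definition exchange A : Prop :=
  forall u v, A u -> A v -> forall i, (v i < u i)%N ->
  exists2 j, (u j < v j)%N & A (u - U_(i) + U_(j))%MM.

Definition msum A B : 'X_{1..n} -> Prop :=
  fun m => exists a b, [/\ A a, B b & m = (a + b)%MM].

Definition mpow A (k : nat) : 'X_{1..n} -> Prop :=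
  iter k (msum A) (fun m => m = 0%MM).

Definition multiples_of_degree A (j : nat) : 'X_{1..n} -> Prop :=
  fun m => mdeg m = j /\ exists2 a, A a & (a <= m)%MM.

Lemma exchange_ext A B : (forall m, A m <-> B m) -> exchange A -> exchange B.
Proof.
move=> AB exA u v /AB Au /AB Av i lt_i.
by have [j lt_j /AB Bj] := exA u v Au Av i lt_i; exists j.
Qed.

Lemma swap_addl a b x (i j l : 'I_n) : (0 < a j)%N ->
  (a + b = x - U_(i) + U_(j) -> a - U_(j) + U_(l) + b = x - U_(i) + U_(l))%MM.
Proof.
move=> a_j /mnmP e; apply/mnmP => t; move: (e t).
rewrite !(mnmDE, mnmBE, mnm1E).
by have [<-|_] := eqVneq j t; case: (_ == _); case: (_ == _) => /=; lia.
Qed.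

(** The summand exceeds its target at [j] and falls short at [l], so moving a
    unit from [j] to [l] decreases the total excess over the target. *)
Lemma swap_excess (a a' : 'X_{1..n}) (j l : 'I_n) : (a' j < a j)%N -> (a l < a' l)%N ->
  (mdeg (a - U_(j) + U_(l) - a')%MM < mdeg (a - a')%MM)%N.
Proof.
move=> lt_j lt_l.
have -> : (a - a' = (a - U_(j) + U_(l) - a') + U_(j))%MM.
  apply/mnmP => t; rewrite !(mnmDE, mnmBE, mnm1E).
  have [e|_] := eqVneq j t; first subst t;
    by have [e|_] := eqVneq l _; try subst l; move=> /=; lia.
by rewrite mdegD mdeg1; lia.
Qed.

(** The exchange process for a Minkowski sum, in the middle of its run: [a + b]
    is [x] with a unit already moved from [i] to [j], and it exceeds [a' + b']
    at [j].  The induction is on the excess of [a] over [a'] and of [b] over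
    [b']. *)
Lemma exchange_descent A B (a' b' : 'X_{1..n}) x (i j : 'I_n) a b :
    exchange A -> exchange B -> A a' -> B b' -> ((a' + b')%MM i < x i)%N ->
    A a -> B b -> (a + b = x - U_(i) + U_(j))%MM ->
    ((a' + b')%MM j < (a + b)%MM j)%N ->
  exists2 l, (x l < (a' + b')%MM l)%N & msum A B (x - U_(i) + U_(l))%MM.
Proof.
move=> exA exB Aa' Bb' lt_i.
have [N] := ubnP (mdeg (a - a')%MM + mdeg (b - b')%MM)%N.
elim: N => // N IHN in a b j * => ltN Aa Bb e lt_j.
have stop_or_go a1 b1 l : A a1 -> B b1 -> (a1 + b1 = x - U_(i) + U_(l))%MM ->
    (mdeg (a1 - a')%MM + mdeg (b1 - b')%MM <
       mdeg (a - a')%MM + mdeg (b - b')%MM)%N ->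
    exists2 l, (x l < (a' + b')%MM l)%N & msum A B (x - U_(i) + U_(l))%MM.
  move=> Aa1 Bb1 e1 lt1.
  have [lt_l|le_l] := ltnP (x l) ((a' + b')%MM l).
    by exists l => //; exists a1, b1.
  apply: (IHN a1 b1 l) => //; first by lia.
  (* Either [l = i] and the vector is [x] again, or it has gained a unit at
     [l]. *)
  rewrite e1; move: le_l lt_i; rewrite !(mnmDE, mnmBE, mnm1E) eqxx.
  by have [<-|_] := eqVneq i l; lia.
have [lt_a|lt_b] : (a' j < a j)%N \/ (b' j < b j)%N.
  by move: lt_j; rewrite !mnmDE; lia.
  have [l lt_l Al] := exA _ _ Aa Aa' _ lt_a.
  apply: (stop_or_go _ b l Al) => //; first by apply: swap_addl => //; lia.
  by rewrite ltn_add2r swap_excess.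
have [l lt_l Bl] := exB _ _ Bb Bb' _ lt_b.
apply: (stop_or_go a _ l Aa Bl); last by rewrite ltn_add2l swap_excess.
by rewrite addmC; apply: (swap_addl (j := j)); [lia | rewrite addmC].
Qed.

Lemma exchange_msum A B : exchange A -> exchange B -> exchange (msum A B).
Proof.
move=> exA exB _ _ [a [b [Aa Bb ->]]] [a' [b' [Aa' Bb' ->]]] i lt_i.
apply: (exchange_descent exA exB Aa' Bb' lt_i Aa Bb) (lt_i).
apply/mnmP => t; move: lt_i; rewrite !(mnmDE, mnmBE, mnm1E).
by have [<-|_] := eqVneq i t; lia.
Qed.

Lemma exchange_mpow A k : exchange A -> exchange (mpow A k).
Proof.
move=> exA; elim: k => [|k IHk] /=; last exact: exchange_msum.
by move=> u v -> -> i; rewrite ltnn.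
Qed.

(** If no coordinate of [u] were below that of [v], then [v <= u], and the
    strict inequality at [i] would contradict the equality of degrees. *)
Lemma exchange_mdeg d : exchange (fun m => mdeg m = d).
Proof.
move=> u v du dv i lt_i.
case: (pickP (fun j => u j < v j)%N) => [j lt_j|ge_u].
  exists j => //.
  have le_i : (U_(i) <= u)%MM.
    apply/mnm_lepP => t; rewrite mnm1E; have [<-|//] := eqVneq i t; lia.
  have := mdegD (u - U_(i)) U_(i); rewrite submK // mdeg1 du => e.
  by rewrite mdegD mdeg1; lia.
have le_vu : (v <= u)%MM by apply/mnm_lepP => t; rewrite leqNgt ge_u.
have := mdegD (u - v) v; rewrite submK // du dv => e.
have /eqP : mdeg (u - v)%MM = 0%N by lia.
by rewrite mdeg_eq0 => /eqP/mnmP/(_ i); rewrite mnmBE mnm0E; lia.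
Qed.

Lemma mdeg_msum A B d e : (forall m, A m -> mdeg m = d) ->
  (forall m, B m -> mdeg m = e) -> forall m, msum A B m -> mdeg m = (d + e)%N.
Proof. by move=> dA dB _ [a [b [/dA <- /dB <- ->]]]; rewrite mdegD. Qed.

Lemma mdeg_mpow A d : (forall m, A m -> mdeg m = d) ->
  forall k m, mpow A k m -> mdeg m = (k * d)%N.
Proof.
move=> dA; elim=> [m ->|k IHk m]; first by rewrite mdeg0.
by move/(mdeg_msum dA IHk) => ->; rewrite mulSn.
Qed.

Lemma lep0m m : (0 <= m)%MM.
Proof. by apply/mnm_lepP => i; rewrite mnm0E. Qed.

Lemma mdeg_sub_le m u : (u <= m)%MM -> mdeg (m - u)%MM = (mdeg m - mdeg u)%N.
Proof. by move=> le_u; rewrite -{2}(submK le_u) mdegD addnK. Qed.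

(** Passing to multiples of a fixed degree is a Minkowski sum with a power of
    the maximal ideal. *)
Lemma exchange_multiples A d j : (forall m, A m -> mdeg m = d) ->
  exchange A -> exchange (multiples_of_degree A j).
Proof.
move=> dA exA; have [lt_jd|le_dj] := ltnP j d.
  move=> u v [du [a /dA da le_a]]; have := mdeg_sub_le le_a.
  have := mdegD (u - a) a; rewrite submK // => *; lia.
apply: exchange_ext (exchange_msum exA (@exchange_mdeg (j - d))) => m.
split=> [[a [b [Aa db ->]]]|[dm [a Aa le_a]]].
  split; last by exists a => //; apply: lem_addr.
  by rewrite mdegD db (dA _ Aa) subnKC.
exists a, (m - a)%MM; split=> //; last by rewrite addmC submK.
by rewrite mdeg_sub_le // dm (dA _ Aa).
Qed.

Lemma mdeg_lower m d : (d <= mdeg m)%N -> exists2 t, (t <= m)%MM & mdeg t = d.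
Proof.
elim: d => [|d IHd] le_d; first by exists 0%MM; rewrite ?lep0m ?mdeg0.
have [t le_t dt] := IHd (ltnW le_d).
case: (pickP (fun i => t i < m i)%N) => [i lt_i|ge_t].
  exists (t + U_(i))%MM; last by rewrite mdegD mdeg1 dt addn1.
  apply/mnm_lepP => l; rewrite mnmDE mnm1E; have := mnm_lepP le_t l.
  by have [<-|_] := eqVneq i l; lia.
have e : t = m by apply/mnmP => l; have := mnm_lepP le_t l; have := ge_t l; lia.
by move: le_d; rewrite -e dt ltnn.
Qed.

Lemma mpow_union P Q k m : mpow (fun m => P m \/ Q m) k m ->
  exists2 q, (q <= k)%N & msum (mpow P (k - q)) (mpow Q q) m.
Proof.
elim: k m => [m ->|k IHk _ [a [b [PQa /IHk [q le_q [c [d [Pc Qd ->]]]] ->]]]].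
  by exists 0%N => //; exists 0%MM, 0%MM; rewrite addm0.
case: PQa => [Pa|Qa]; last first.
  exists q.+1 => //; exists c, (a + d)%MM.
  by split; [rewrite subSS | exists a, d | rewrite !addmA (addmC a)].
exists q; first exact: leqW.
exists (a + c)%MM, d; split; rewrite ?addmA // subSn //.
by exists a, c.
Qed.

Lemma mpow_sub P Q : (forall m, P m -> Q m) ->
  forall k m, mpow P k m -> mpow Q k m.
Proof.
move=> PQ; elim=> [//|k IHk] _ [a [b [/PQ Qa /IHk Qb ->]]].
by exists a, b.
Qed.

Lemma msum_mpow_add P k l m : msum (mpow P k) (mpow P l) m -> mpow P (k + l) m.
Proof.
elim: k m => [|k IHk] _ [a [b [Pa Pb ->]]]; first by rewrite Pa add0m.
have [c [d [Pc Pd ->]]] := Pa.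
by exists c, (d + b)%MM; rewrite addmA; split=> //; apply: IHk; exists d, b.
Qed.

End ExchangeSets.

(** * Powers of a set generated in two degrees *)

Section TwoDegrees.
Variables (n : nat) (M : 'X_{1..n} -> Prop).
Hypothesis up_M : forall u v, M u -> (u <= v)%MM -> M v.
Variables d1 d2 : nat.
Hypothesis le_d12 : (d1 <= d2)%N.

Let P m := mdeg m = d1 /\ M m.
Let Q m := mdeg m = d2 /\ M m.

Let mixed k q := msum (mpow P (k - q)) (mpow Q q).

Let mdeg_mixed k q m :
  mixed k q m -> mdeg m = ((k - q) * d1 + q * d2)%N.
Proof. by apply: mdeg_msum; apply: mdeg_mpow => ? []. Qed.

(** Since [j] leaves room for a factor of degree [d2 - d1], such a factor can be
    absorbed into one of the [P]-summands, which turns it into an element of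
    [Q]. *)
Lemma two_degree_multiples_step k q j m : (q < k)%N ->
  ((k - q.+1) * d1 + q.+1 * d2 <= j)%N ->
  multiples_of_degree (mixed k q) j m ->
  multiples_of_degree (mixed k q.+1) j m.
Proof.
move=> lt_qk le_j [dm [s mix_s le_s]]; split=> //.
have ds := mdeg_mixed mix_s.
case: mix_s le_s ds => [p [r [Pp Qr ->]]].
rewrite (_ : k - q = (k - q.+1).+1)%N in Pp *; last by lia.
have [c [p' [[dc Mc] Pp' ->]]] := Pp => le_s ds.
have [t le_t dt] : exists2 t, (t <= m - (c + p' + r))%MM & mdeg t = (d2 - d1)%N.
  by apply: mdeg_lower; rewrite mdeg_sub_le // ds dm; lia.
exists (p' + ((c + t) + r))%MM.
  exists p', (c + t + r)%MM; split=> //; exists (c + t)%MM, r; split=> //.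
  split; first by rewrite mdegD dc dt subnKC.
  by apply: up_M Mc _; apply: lem_addr.
apply/mnm_lepP => l; have := mnm_lepP le_t l; have := mnm_lepP le_s l.
by rewrite !(mnmDE, mnmBE); lia.
Qed.

Lemma two_degree_multiples_mono k q q' j m : (q <= q' <= k)%N ->
  ((k - q') * d1 + q' * d2 <= j)%N ->
  multiples_of_degree (mixed k q) j m ->
  multiples_of_degree (mixed k q') j m.
Proof.
move=> /andP[]; elim: q' => [|q' IHq]; first by rewrite leqn0 => /eqP->.
rewrite leq_eqVlt => /orP[/eqP-> //|le_q] le_k le_j mult.
apply: two_degree_multiples_step => //; apply: IHq => //; first exact: ltnW.
apply: leq_trans le_j.
by rewrite (_ : k - q' = (k - q'.+1).+1)%N; [rewrite !mulSn; lia | lia].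
Qed.

Lemma two_degree_power_exchange k j : exchange P -> exchange Q ->
  exchange (multiples_of_degree (mpow (fun m => P m \/ Q m) k) j).
Proof.
move=> exP exQ.
set fits := fun q => ((q <= k) && ((k - q) * d1 + q * d2 <= j))%N.
have fits_mult q m : (q <= k)%N ->
    multiples_of_degree (mixed k q) j m -> fits q.
  move=> le_q [dm [s /mdeg_mixed ds le_s]]; rewrite /fits le_q -ds -dm.
  by rewrite -(submK le_s) mdegD leq_addl.
have split_mult m : multiples_of_degree (mpow (fun m => P m \/ Q m) k) j m ->
    exists2 q, (q <= k)%N & multiples_of_degree (mixed k q) j m.
  move=> [dm [s /mpow_union [q le_q mix_s] le_s]].
  by exists q => //; split=> //; exists s.
have [some|none] := boolP [exists q : 'I_k.+1, fits q]; last first.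
  move=> u v /split_mult [q le_q /(fits_mult _ _ le_q) fit_q].
  case/negP: none; apply/existsP.
  by exists (Ordinal (le_q : (q < k.+1)%N)).
have ex_fits : exists q, fits q by have /existsP[q] := some; exists q.
have bnd q : fits q -> (q <= k)%N by case/andP.
case: (ex_maxnP ex_fits bnd) => q /andP[le_qk le_j] max_q.
apply: (exchange_ext (A := multiples_of_degree (mixed k q) j)); last first.
  apply: (exchange_multiples (d := (k - q) * d1 + q * d2)).
    exact: mdeg_mixed.
  by apply: exchange_msum; apply: exchange_mpow.
move=> m; split.
  move=> [dm [_ [a [b [Pa Qb ->]]] le_s]].
  split=> //; exists (a + b)%MM => //.
  rewrite -(subnK le_qk); apply: msum_mpow_add; exists a, b.
  by split=> //; [apply: mpow_sub Pa | apply: mpow_sub Qb] => ? ?; [left | right].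
move=> /split_mult [q' le_q' multm].
apply: (two_degree_multiples_mono _ le_j multm).
by rewrite le_qk andbT; apply: max_q; exact: fits_mult multm.
Qed.

End TwoDegrees.

(** * Translation to monomial ideals *)

Section Ideals.
Variables (K : fieldType) (n : nat).
Implicit Types (I J : {mpoly K[n]} -> Prop) (B C : 'X_{1..n} -> Prop).

Lemma generatesX B I m :
  generates B I -> I 'X_[m] <-> exists2 b, B b & (b <= m)%MM.
Proof. by move=> ->; apply: monomial_genXP. Qed.

Lemma generates_ideal_mul B C I J : generates B I -> generates C J ->
  generates (msum B C) (ideal_mul I J).
Proof.
move=> gB gC p; split=> [hp|/monomial_genP hp].
  apply: hp; first exact: ideal_gen_ideal.
  move=> _ [a [b [/gB/monomial_genP Ia /gC/monomial_genP Jb ->]]].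
  apply/monomial_genP => m /msuppM_le/allpairsP [[m1 m2] /= [/Ia m1B /Jb m2C ->]].
  case: m1B m2C => [c Bc le_c] [d Cd le_d].
  exists (c + d)%MM; first by exists c, d.
  by apply/mnm_lepP => t; rewrite !mnmDE leq_add // (mnm_lepP _).
move=> L idL hL; have /monomial_genP := hp; apply => //.
move=> _ [_ [b [c [Bb Cc ->]]] ->]; apply: hL.
exists 'X_[b], 'X_[c]; rewrite mpolyXD.
by split=> //; [apply/(generatesX _ gB); exists b | apply/(generatesX _ gC); exists c];
  rewrite ?lepm_refl.
Qed.

Lemma generates_ideal_exp B I k :
  generates B I -> generates (mpow B k) (ideal_exp I k).
Proof.
move=> gB; elim: k => [p|k IHk]; last exact: generates_ideal_mul.
split=> // _; apply/monomial_genP => m _.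
by exists 0%MM => //; apply: lep0m.
Qed.

Lemma component_monomial I j : monomial_ideal (component I j).
Proof. by exists (fun m => mdeg m = j /\ I 'X_[m]). Qed.

(** Monomials of equal degree do not divide one another properly. *)
Lemma mingens_component I j u :
  mingens (component I j) u <-> mdeg u = j /\ I 'X_[u].
Proof.
rewrite mingensE; last exact: component_monomial.
split=> [|[du Iu]].
  exact: (@div_minimal_sub _ _ (fun m => mdeg m = j /\ I 'X_[m])).
split; first by apply/monomial_genXP; exists u => //; apply: lepm_refl.
move=> v /monomial_genXP [b [db _] le_b] le_v.
have le_uv : (mdeg u <= mdeg v)%N.
  by rewrite du -db -(submK le_b) mdegD leq_addl.
have /eqP : mdeg (u - v)%MM = 0%N by rewrite mdeg_sub_le //; lia.
by rewrite mdeg_eq0 => /eqP e; rewrite -(submK le_v) e add0m.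
Qed.

(** The exchanged monomial has degree [j] again, so membership in the
    ideal spanned by the degree [j] part is membership in that part. *)
Lemma polymatroidal_componentP I j :
  polymatroidal (component I j) <->
  exchange (fun m => mdeg m = j /\ I 'X_[m]).
Proof.
split=> [[_ _ ex] u v Iu Iv i lt_i|ex].
  have [|| l lt_l] := ex u v _ _ i lt_i; [exact/mingens_component..|].
  move/monomial_genXP => [b Ib le_b]; exists l => //.
  have le_i : (U_(i) <= u)%MM.
    by apply/mnm_lepP => t; rewrite mnm1E; have [<-|//] := eqVneq i t; lia.
  have dw : mdeg (u - U_(i) + U_(l))%MM = j.
    have := mdegD (u - U_(i)) U_(i); rewrite submK // (proj1 Iu) mdegD !mdeg1.
    by move->.
  have /eqP : mdeg (u - U_(i) + U_(l) - b)%MM = 0%N.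
    by rewrite mdeg_sub_le // dw (proj1 Ib) subnn.
  by rewrite mdeg_eq0 => /eqP e; rewrite -(submK le_b) e add0m.
split; first exact: component_monomial.
  by move=> u v /mingens_component [-> _] /mingens_component [-> _].
move=> u v /mingens_component Iu /mingens_component Iv i lt_i.
have [l lt_l Il] := ex u v Iu Iv i lt_i; exists l => //.
by apply/monomial_genXP; exists (u - U_(i) + U_(l))%MM => //; apply: lepm_refl.
Qed.

Lemma generates_two_degrees I d1 d2 : monomial_ideal I ->
  (forall u, mingens I u -> mdeg u = d1 \/ mdeg u = d2) ->
  generates (fun m => (mdeg m = d1 /\ I 'X_[m]) \/ (mdeg m = d2 /\ I 'X_[m])) I.
Proof.
move=> monI hd p; have gI := div_minimal_generates monI.
split=> [/gI/monomial_genP hp|/monomial_genP hp].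
  apply/monomial_genP => m /hp [b min_b le_b]; exists b => //.
  by have [Ib _] := min_b; have /(mingensE _ monI)/hd [] := min_b; [left|right].
apply/gI/monomial_genP => m /hp [b Ib le_b].
have /(generatesX _ gI) [c min_c le_c] : I 'X_[b] by case: Ib => -[].
by exists c => //; apply: lepm_trans le_c le_b.
Qed.

End Ideals.

Theorem proposition3p2 (K : fieldType) (n : nat) (I : {mpoly K[n]} -> Prop)
    (hI : componentwise_polymatroidal I)
    (h2 : generated_in_at_most_two_degrees I)
    (k : nat) (hk : (1 <= k)%N) :
  componentwise_polymatroidal (ideal_exp I k).
Proof.
have [monI polyI] := hI; have [d1 [d2 hd]] := h2.
wlog le_d : d1 d2 hd / (d1 <= d2)%N.
  move=> wl; have [|/ltnW le_d] := leqP d1 d2; first exact: wl.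
  by apply: (wl d2 d1) => // u /hd [] ?; [right|left].
have gI := generates_ideal_exp k (generates_two_degrees monI hd).
split; first by eexists; apply: gI.
move=> j; apply/polymatroidal_componentP.
have up_I u v : I 'X_[u] -> (u <= v)%MM -> I 'X_[v].
  have [B gB] := monI; move=> /(generatesX _ gB) [b Bb le_b] le_v.
  by apply/(generatesX _ gB); exists b => //; apply: lepm_trans le_b le_v.
apply: exchange_ext (two_degree_power_exchange up_I le_d (k := k) (j := j) _ _);
  try exact/polymatroidal_componentP.
by move=> m; split=> -[dm hm]; split=> //; apply/(generatesX _ gI).
Qed.
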